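(* Let $D_1,\dots,D_6$ be the six oriented diagrams in the plane $\mathbb{R}^2$ described in the context: $D_1,D_2$ are diagrams of the trefoil knot, $D_3,D_4$ are diagrams of the figure-eight knot, and $D_5,D_6$ are diagrams of the $(2,4)$-torus link. For oriented diagrams $D,D'$ of the same knot or link, let $\Omega_3(D,D')$ be the minimal number of Reidemeister moves of type III over all finite sequences of Reidemeister moves (types I, II, III) and planar isotopies in $\mathbb{R}^2$ connecting $D$ and $D'$. Then (i) $\Omega_3(D_1,D_2)=2$; (ii) $\Omega_3(D_3,D_4)=3$; (iii) $\Omega_3(D_5,D_6)=3$.
   Context: All diagrams are oriented link diagrams in the plane $\mathbb{R}^2$ (not in the sphere $S^2$), considered up to planar isotopy. Any two oriented diagrams in $\mathbb{R}^2$ of the same oriented knot or link are connected by a finite sequence of Reidemeister moves of types I, II, III (with all choices of orientations of strands and of crossing information allowed) and planar isotopies. $\Omega_3(D,D')$ is the minimal number of type III moves in such a sequence. Torus-type diagrams. For $n\ge 1$ let $\beta_n$ be the vertical 2-strand braid diagram with $n$ crossings, both strands oriented upward, such that at each crossing the over-strand goes from lower left to upper right (so all crossings are positive). It has four endpoints: top left, top right, bottom left, bottom right. - Let $E_n$ be the diagram obtained from $\beta_n$ by joining top left to bottom left and top right to bottom right by two disjoint simple arcs which both pass around the left side of $\beta_n$, the arc joining the right endpoints passing outside the other one, with no new crossings (the standard closed 2-braid, winding counterclockwise). - Let $F_n$ be the diagram obtained from $\beta_n$ by joining top left to bottom left by a simple arc passing around the left side of $\beta_n$ and top right to bottom right by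 a simple arc passing around the right side of $\beta_n$, with no new crossings. Set $D_1=F_3$, $D_2=E_3$, $D_5=F_4$, $D_6=E_4$. (As diagrams on $S^2=\mathbb{R}^2\cup\{\infty\}$, $F_n$ and $E_n$ coincide; $F_n$ is carried to $E_n$ by throwing its outermost right arc through $\infty$.) Figure-eight diagrams. Let $G$ be the oriented four-crossing alternating diagram of the figure-eight knot on $S^2$, with crossings $A,B$ positive and $C,D$ negative, whose cyclic Gauss word, read along the orientation, is $$D_U\;B_O\;A_U\;D_O\;C_U\;A_O\;B_U\;C_O,$$ where the subscript $O$ (resp. $U$) means that the strand passes over (resp. under) at that crossing. Name its oriented edges in order: $e_1:D\to B$, $e_2:B\to A$, $e_3:A\to D$, $e_4:D\to C$, $e_5:C\to A$, $e_6:A\to B$, $e_7:B\to C$, $e_8:C\to D$. The complementary regions of $G$ in $S^2$ are two bigons, with boundary edges $\{e_2,e_6\}$ and $\{e_4,e_8\}$, and four triangles, with boundary edges $\{e_1,e_3,e_6\}$, $\{e_3,e_5,e_8\}$, $\{e_2,e_5,e_7\}$, $\{e_1,e_4,e_7\}$. - $D_4$ is the planar diagram obtained from $G$ by putting $\infty$ in the triangle with boundary edges $\{e_1,e_3,e_6\}$ (so this triangle is the outermost region). - $D_3$ is the planar diagram obtained from $G$ by putting $\infty$ in the triangle with boundary edges $\{e_1,e_4,e_7\}$. In both cases the plane $\mathbb{R}^2=S^2\setminus\{\infty\}$ carries the orientation of $S^2$, and the signs of the crossings are as given. *)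

(* Defs.v *)
From mathcomp Require Import all_boot.

Set Implicit Arguments.
Unset Strict Implicit.
Unset Printing Implicit Defensive.

(* Oriented link diagrams in the plane, in generic position with respect to   *)
(* the height function: such a diagram is the sequence, from bottom to top,   *)
(* of its local minima, local maxima and crossings, each one given with the   *)
(* number of strands that pass to the left of it at its height.  Diagrams     *)
(* need not be connected, and may have components without crossings.          *)
Inductive piece : Type :=
  | Cup of bool     (* local minimum; true: its left leg is oriented upward  *)
  | Cap             (* local maximum                                         *)
  | Cross of bool.  (* true: the strand from lower left to upper right is    *)
                    (* the over-strand; false: it is the under-strand        *)

Definition event : Type := (piece * nat)%type.

Definition legs_below (a : piece) : nat := if a is Cup _ then 0 else 2.
Definition legs_above (a : piece) : nat := if a is Cap then 0 else 2.

(* A level is the sequence, from left to right, of the orientations of the    *)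
(* strands at a given height (true: upward).  The result is None if the event *)
(* does not fit the level below it, in particular if a maximum would join two *)
(* strands with incompatible orientations.                                    *)
Definition act (e : event) (s : seq bool) : option (seq bool) :=
  let: (a, i) := e in
  match a with
  | Cup d =>
      if i <= size s then Some (take i s ++ [:: d; ~~ d] ++ drop i s) else None
  | Cap =>
      if drop i s is x :: y :: s' then
        if x != y then Some (take i s ++ s') else None
      else None
  | Cross _ =>
      if drop i s is x :: y :: s' then Some (take i s ++ [:: y, x & s'])
      else None
  end.

Definition run (w : seq event) (s : seq bool) : option (seq bool) :=
  foldl (fun o e => obind (act e) o) (Some s) w.

Definition is_closed (w : seq event) : bool := run w [::] == Some [::].

Definition diagram : Type := {w : seq event | is_closed w}.

(* Planar isotopy is generated by the changes that a diagram undergoes when   *)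
(* it stops, at one instant, being generic for the height function: exchange  *)
(* of the heights of two pieces lying side by side, birth or death of a pair  *)
(* minimum-maximum along a strand, and passage of a crossing through a local  *)
(* extremum of one of its two strands.                                        *)
Inductive isotopy_rule : seq event -> seq event -> Prop :=
  | Exchange a b i k :
      isotopy_rule [:: (a, i); (b, i + legs_above a + k)]
                   [:: (b, i + legs_below a + k); (a, i)]
  | ZigzagL d i : isotopy_rule [:: (Cup d, i); (Cap, i.+1)] [::]
  | ZigzagR d i : isotopy_rule [:: (Cup d, i.+1); (Cap, i)] [::]
  | SlideCap s i :
      isotopy_rule [:: (Cross s, i); (Cap, i.+1)]
                   [:: (Cross (~~ s), i.+1); (Cap, i)]
  | SlideCup d s i :
      isotopy_rule [:: (Cup d, i); (Cross s, i.+1)]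
                   [:: (Cup d, i.+1); (Cross (~~ s), i)].

(* The kink lies to the right (KinkR) or to the left (KinkL) of a vertical    *)
(* strand; s is the type of its crossing.  All rules apply to either          *)
(* orientation of each strand, as orientations are carried by the minima.     *)
Inductive R1_rule : seq event -> seq event -> Prop :=
  | KinkR d s i :
      R1_rule [:: (Cup d, i.+1); (Cross s, i); (Cap, i.+1)] [::]
  | KinkL d s i :
      R1_rule [:: (Cup d, i); (Cross s, i.+1); (Cap, i)] [::].

Inductive R2_rule : seq event -> seq event -> Prop :=
  | Bigon s i : R2_rule [:: (Cross s, i); (Cross (~~ s), i)] [::].

(* Number the three strands from left to right at the bottom: r, s and t say  *)
(* whether strand 1 is over strand 2, strand 1 over strand 3, and strand 2    *)
(* over strand 3.  The side condition says that this is a linear order of     *)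
(* the strands and not a cyclic pattern.                                      *)
Inductive R3_rule : seq event -> seq event -> Prop :=
  | Triangle r s t i : (r == t) ==> (s == r) ->
      R3_rule [:: (Cross r, i); (Cross s, i.+1); (Cross t, i)]
              [:: (Cross t, i.+1); (Cross s, i); (Cross r, i.+1)].

Definition local_move (rule : seq event -> seq event -> Prop)
    (D D' : diagram) : Prop :=
  exists u v l r : seq event,
    [/\ val D = u ++ l ++ v, val D' = u ++ r ++ v & rule l r \/ rule r l].

(* [joined k D D']: some finite sequence of planar isotopies and Reidemeister *)
(* moves with exactly k moves of type III leads from D to D'.                 *)
Inductive joined : nat -> diagram -> diagram -> Prop :=
  | joined_refl D : joined 0 D D
  | joined_isotopy k D D' D'' :
      local_move isotopy_rule D D' -> joined k D' D'' -> joined k D D''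
  | joined_R1 k D D' D'' :
      local_move R1_rule D D' -> joined k D' D'' -> joined k D D''
  | joined_R2 k D D' D'' :
      local_move R2_rule D D' -> joined k D' D'' -> joined k D D''
  | joined_R3 k D D' D'' :
      local_move R3_rule D D' -> joined k D' D'' -> joined k.+1 D D''.

Definition Omega3_eq (D D' : diagram) (m : nat) : Prop :=
  joined m D D' /\ (forall k, joined k D D' -> m <= k).

Definition beta (n i : nat) : seq event := nseq n (Cross true, i).

Definition E_word (n : nat) : seq event :=
  [:: (Cup false, 0); (Cup false, 1)] ++ beta n 2 ++ [:: (Cap, 1); (Cap, 0)].

Definition F_word (n : nat) : seq event :=
  [:: (Cup false, 0); (Cup true, 2)] ++ beta n 1 ++ [:: (Cap, 0); (Cap, 0)].

Lemma E_closed n : is_closed (E_word n).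
Proof.
rewrite /is_closed /run /E_word !foldl_cat /=.
suff -> : foldl (fun o e => obind (act e) o)
            (Some [:: false; false; true; true]) (beta n 2)
          = Some [:: false; false; true; true] by [].
by elim: n.
Qed.

Lemma F_closed n : is_closed (F_word n).
Proof.
rewrite /is_closed /run /F_word !foldl_cat /=.
suff -> : foldl (fun o e => obind (act e) o)
            (Some [:: false; true; true; false]) (beta n 1)
          = Some [:: false; true; true; false] by [].
by elim: n.
Qed.

Definition E (n : nat) : diagram := exist _ (E_word n) (E_closed n).
Definition F (n : nat) : diagram := exist _ (F_word n) (F_closed n).

(* The lemmas D3_spec and D4_spec below check these two words against the     *)
(* signed Gauss word of the alternating four-crossing diagram of the          *)
(* figure-eight knot and against the choice of its unbounded region.          *)
Definition D3_word : seq event :=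
  [:: (Cup true, 0); (Cup true, 1);
      (Cross true, 2); (Cross false, 1); (Cross true, 2); (Cross true, 2);
      (Cap, 1); (Cap, 0)].

Definition D4_word : seq event :=
  [:: (Cup true, 0); (Cup false, 1);
      (Cross false, 0); (Cross false, 2); (Cross true, 1); (Cross true, 1);
      (Cap, 2); (Cap, 0)].

Definition D1 : diagram := F 3.
Definition D2 : diagram := E 3.
Definition D3 : diagram := exist _ D3_word (isT : is_closed D3_word).
Definition D4 : diagram := exist _ D4_word (isT : is_closed D4_word).
Definition D5 : diagram := F 4.
Definition D6 : diagram := E 4.

Section GaussCode.

Variable w : seq event.

Definition level (t : nat) : seq bool := odflt [::] (run (take t w) [::]).

(* The point (t, p, up) lies on the p-th strand from the left, between the    *)
(* events t - 1 and t of w, and is about to move upward iff up.  [advance]    *)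
(* goes past one event, and returns that crossing if the strand goes through  *)
(* it, with true iff the strand is over there.                                *)
Definition advance (x : nat * nat * bool) :
    (nat * nat * bool) * option (nat * bool) :=
  let: (t, p, up) := x in
  let: (a, i) := nth (Cap, 0) w (if up then t else t.-1) in
  let: (here, there) := if up then (legs_below a, legs_above a)
                        else (legs_above a, legs_below a) in
  let t' := if up then t.+1 else t.-1 in
  if p < i then ((t', p, up), None)
  else if i + here <= p then ((t', p - here + there, up), None)
  else let q := i + i.+1 - p in
    if a is Cross s then
      ((t', q, up), Some (if up then t else t.-1, s == ((p == i) == up)))
    else ((t, q, ~~ up), None).

Definition point (x : nat * nat * bool) (n : nat) : nat * nat * bool :=
  iter n (fun y => (advance y).1) x.

(* The passages through crossings met during the first n steps from x.        *)
Definition gauss (x : nat * nat * bool) (n : nat) : seq (nat * bool) :=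
  pmap (fun k => (advance (point x k)).2) (iota 0 n).

(* The edges having a point that is leftmost or rightmost at its height, all  *)
(* of which border the unbounded region; the edge number m is the one         *)
(* entered after m passages.                                                  *)
Definition outer_edges (x : nat * nat * bool) (n : nat) : seq nat :=
  sort leq (undup [seq size (gauss x k) | k <- iota 0 n &
    let: (t, p, _) := point x k in (p == 0) || (p.+1 == size (level t))]).

Definition positive (c : nat) : bool :=
  if nth (Cap, 0) w c is (Cross s, i) then
    s == (nth true (level c) i == nth true (level c) i.+1)
  else false.

(* [x] is a point of the edge e_8; the names of the crossings are the indices *)
(* of the corresponding events of w.                                          *)
Definition figure_eight_spec (A B C D : nat) (outer : seq nat)
    (x : nat * nat * bool) (n : nat) : bool :=
  [&& uniq [:: A; B; C; D],
      n == sumn [seq size (level t) | t <- iota 0 (size w)],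
      uniq [seq point x k | k <- iota 0 n], point x n == x,
      gauss x n == [:: (D, false); (B, true); (A, false); (D, true);
                       (C, false); (A, true); (B, false); (C, true)],
      [&& positive A, positive B, ~~ positive C & ~~ positive D]
    & outer_edges x n == outer].

End GaussCode.


(* No two of the six regions of the figure-eight diagram on the sphere have   *)
(* the same boundary edges, so these edges identify the region that contains  *)
(* the point at infinity.                                                     *)
Lemma D3_spec :
  figure_eight_spec D3_word 3 2 5 4 [:: 1; 4; 7] (5, 2, false) 24.
Proof. by vm_compute. Qed.

Lemma D4_spec :
  figure_eight_spec D4_word 3 2 4 5 [:: 1; 3; 6] (5, 2, true) 24.
Proof. by vm_compute. Qed.

(* Main.v *)
(* The lower bounds come from Fox colourings of the diagram by Z/n (n = 3, 5  *)
(* and 4 respectively), where each crossing between arcs of colours x and y   *)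
(* is counted with weight g (x - y) = [x <> y] + [2x <> 2y] and with the sign *)
(* that the checkerboard shading gives to the unoriented crossing.  The       *)
(* moves I, II and planar isotopies preserve this count.  A move III changes  *)
(* it by the parallelogram defect                                             *)
(*   2 g a + 2 g b - g (a + b) - g (a - b)                                    *)
(* up to sign, whose absolute value is at most 7: the value 8 would need      *)
(* g a = g b = 2 and a + b = a - b = 0, hence 2 a = 0 and g a < 2.  Throwing  *)
(* an arc through infinity exchanges the two classes of the shading, so the   *)
(* count of a colouring with nonconstant 2x goes from -+2m to +-2m, m being   *)
(* the number of crossings; the change 4m is 12 > 7 or 16 > 2 * 7.            *)
Require Import Defs.
From mathcomp Require Import all_boot all_order all_algebra.
From mathcomp Require Import zify ring.

Set Implicit Arguments.
Unset Strict Implicit.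
Unset Printing Implicit Defensive.

Import Order.TTheory GRing.Theory Num.Theory.
Open Scope ring_scope.

(** Every move is local, so it suffices to recolour the rewritten word while keeping the colours at
    its bottom and top levels ([equilift]). A colouring is thus carried along any sequence of moves,
    stays nontrivial, and after k moves III its count has changed by at most 7k ([joined_lift]). A
    finite enumeration shows that some nontrivial colouring of the first diagram has count u and all
    those of the second have count -u, with |u| = 6, 8, 8; so 12 <= 7k or 16 <= 7k ([joined_phi]).
    The upper bounds are explicit sequences. From [F n] to [E n], for n = 3 and 4, one move I
    creates a kink, n - 1 moves III follow, and one move I removes a kink. For the figure-eight knot
    a move II creates a bigon, and after three moves III two kinks are removed. *)

(** * Levels of concatenated and shifted words *)

Lemma run_cons e w s : run (e :: w) s = obind (run w) (act e s).
Proof. by rewrite /run /=; case: (act e s) => //=; elim: w. Qed.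

Lemma run_cat u v s : run (u ++ v) s = obind (run v) (run u s).
Proof.
elim: u s => [|e u IH] s //; rewrite cat_cons !run_cons.
by case: (act e s) => //= s'; apply: IH.
Qed.

Definition shift (w : seq event) : seq event := [seq (e.1, e.2.+1) | e <- w].

Lemma act_shift a i d s : act (a, i.+1) (d :: s) = omap (cons d) (act (a, i) s).
Proof.
case: a => [b||b] /=; first by rewrite ltnS; case: ifP.
  by case: (drop i s) => [|x [|y s']] //; case: ifP.
by case: (drop i s) => [|x [|y s']].
Qed.

Lemma run_shift w d s : run (shift w) (d :: s) = omap (cons d) (run w s).
Proof.
elim: w s => [|[a i] w IH] s //.
by rewrite /= !run_cons act_shift; case: (act _ s) => //= s'; apply: IH.
Qed.

(** * Fox colourings and their signed count *)

Section Fox.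

Variable A : comNzRingType.
Implicit Types (s p q : seq A) (tr : seq (seq A)).

(* The term [2d <> 0] makes the weight of a difference of order 2 smaller; it *)
(* matters only for the colourings by Z/4.                                    *)
Definition gauge (d : A) : int := (d != 0)%:Z + (d + d != 0)%:Z.

Lemma gaugeN d : gauge (- d) = gauge d.
Proof. by rewrite /gauge -opprD !oppr_eq0. Qed.

Lemma gauge0 : gauge 0 = 0.
Proof. by rewrite /gauge addr0 eqxx. Qed.

Lemma gauge_parallelogram a b :
  `|2 * gauge a + 2 * gauge b - gauge (a + b) - gauge (a - b)| <= 7.
Proof.
have bounds d : 0 <= gauge d <= 2.
  by rewrite /gauge; case: (d != 0); case: (d + d != 0).
have pos d : d != 0 -> 1 <= gauge d by rewrite /gauge => ->; case: (d + d != 0).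
have := bounds a; have := bounds b; have := bounds (a + b).
have := bounds (a - b).
have [->|a0] := eqVneq a 0; first by rewrite gauge0; lia.
have [ab|/pos] := eqVneq (a + b) 0; last by lia.
have [ab'|/pos] := eqVneq (a - b) 0; last by lia.
have -> : gauge a = 1; last by lia.
have a2 : a + a = 0 by rewrite -[RHS](addr0 0) -{1}ab -ab'; ring.
by rewrite /gauge a0 a2 eqxx.
Qed.

(* Passing an arc of colour x under one of colour y turns it into 2y - x.     *)
Fixpoint turn (b : bool) (i : nat) (s : seq A) : seq A :=
  match i, s with
  | i.+1, x :: s => x :: turn b i s
  | 0, [:: x, y & s] =>
      if b then [:: x + x - y, x & s] else [:: y, y + y - x & s]
  | _, _ => s
  end.

Fixpoint step (a : piece) (i : nat) (s s' : seq A) : bool :=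
  match i, s, s' with
  | i.+1, x :: s, x' :: s' => (x == x') && step a i s s'
  | i.+1, _, _ => false
  | 0, _, _ =>
    match a with
    | Cup _ => if s' is x :: y :: t then (x == y) && (t == s) else false
    | Cap => if s is x :: y :: t then (x == y) && (t == s') else false
    | Cross b => (1 < size s)%N && (s' == turn b 0 s)
    end
  end.

(* The sign (-1)^(b + i) is the one given by the checkerboard shading, as the *)
(* parity of i tells whether the region to the left of the crossing is        *)
(* shaded.                                                                    *)
Fixpoint weight (a : piece) (i : nat) (s : seq A) : int :=
  match i with
  | i.+1 => - weight a i (behead s)
  | 0 => match a, s with
         | Cross b, x :: y :: _ => (-1) ^+ b * gauge (x - y)
         | _, _ => 0
         end
  end.

(* A colouring is given by the list tr of the colours at the levels above s.  *)
Fixpoint fox (w : seq event) (s : seq A) (tr : seq (seq A)) : bool :=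
  match w, tr with
  | [::], [::] => true
  | (a, i) :: w', s' :: tr' => step a i s s' && fox w' s' tr'
  | _, _ => false
  end.

Fixpoint phi (w : seq event) (s : seq A) (tr : seq (seq A)) : int :=
  match w, tr with
  | (a, i) :: w', s' :: tr' => weight a i s + phi w' s' tr'
  | _, _ => 0
  end.

(* If 2 is invertible in A, this says that all colours are equal to c.        *)
Definition mono (c : A) (s : seq A) : bool := all (fun x => x + x == c + c) s.

Lemma fox_size w s tr : fox w s tr -> size tr = size w.
Proof.
elim: w s tr => [|[a i] w IH] s [|s' tr] //= /andP[_ /IH] ->//.
Qed.

Lemma fox_cat u v s t1 t2 : size t1 = size u ->
  fox (u ++ v) s (t1 ++ t2) = fox u s t1 && fox v (last s t1) t2.
Proof.
elim: u s t1 => [|[a i] u IH] s [|s' t1] //= [/IH] ->; exact: andbA.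
Qed.

Lemma phi_cat u v s t1 t2 : size t1 = size u ->
  phi (u ++ v) s (t1 ++ t2) = phi u s t1 + phi v (last s t1) t2.
Proof.
elim: u s t1 => [|[a i] u IH] s [|s' t1] //= => [_|[/IH ->]].
  by rewrite add0r.
by rewrite addrA.
Qed.

Lemma fox_shift w x s tr :
  fox (shift w) (x :: s) tr ->
  exists2 tr', fox w s tr' & tr = map (cons x) tr'.
Proof.
elim: w s tr => [|[a i] w IH] s [|[|x' s'] tr] //=; first by exists [::].
case/andP=> /andP[/eqP<- st] /IH[tr' f ->].
by exists (s' :: tr'); rewrite //= st.
Qed.

Lemma shift_fox w x s tr :
  fox w s tr -> fox (shift w) (x :: s) (map (cons x) tr).
Proof.
by elim: w s tr => [|[a i] w IH] s [|s' tr] //= /andP[-> /IH->]; rewrite eqxx.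
Qed.

Lemma phi_shift w x s tr :
  phi (shift w) (x :: s) (map (cons x) tr) = - phi w s tr.
Proof.
elim: w s tr => [|[a i] w IH] s [|s' tr] //=; rewrite ?oppr0 //.
by rewrite IH opprD.
Qed.

(* The final level is kept, so that lifts also holds in the context of the    *)
(* rest of the diagram; the last condition makes nontriviality invariant.     *)
Definition lifts (B : int) (l r : seq event) : Prop :=
  forall o s tr, size o = size s -> run r o -> fox l s tr ->
  exists tr', [/\ fox r s tr', last s tr' = last s tr,
    `|phi r s tr' - phi l s tr| <= B
    & forall c, all (mono c) (s :: tr') = all (mono c) (s :: tr)].

(** A new strand on the left flips the shading, hence the sign of every weight; the absolute value
    of the change is the same. *)
Lemma lifts_shift B l r : lifts B l r -> lifts B (shift l) (shift r).
Proof.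
move=> lr [|d o] [|x s] tr //= so.
  (* No shifted event acts on an empty level, so both words are empty; 0 <= B is then read off from
     the hypothesis at the empty level. *)
  case: l r lr => [|[a i] l] [|[b j] r] lr.
  - case: tr => //= _ _; exists [::]; split=> //=; rewrite subrr.
    have [tr' [_ _ h _]] := lr [::] [::] [::] erefl isT isT.
    exact: le_trans (normr_ge0 _) h.
  - by rewrite /= run_cons; case: b lr.
  - by case: tr.
  by case: tr.
case: so => so; rewrite run_shift => rr /fox_shift[tr0 f ->].
have {}rr : run r o by case: (run r o) rr.
have [tr' [f' la ph mo]] := lr o s tr0 so rr f.
exists (map (cons x) tr'); rewrite shift_fox // !(last_map (cons x)) la.
split=> //; first by rewrite !phi_shift -opprD normrN.
have consmono t c : all (mono c) [seq x :: i | i <- t]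
    = ((t == [::]) || (x + x == c + c)) && all (mono c) t.
  elim: t => //= y t ->; case: (t =P [::]) => [->|_] /=; last first.
    by case: (x + x == c + c).
  by rewrite !andbT.
move=> c; have /= := mo c; rewrite /= !consmono.
case: (mono c s) => /= [->|_]; last by rewrite !andbF.
by case: (x + x == c + c) => //=; rewrite !orbT.
Qed.

Lemma fox_consP a i w s tr : fox ((a, i) :: w) s tr ->
  exists s' tr', [/\ tr = s' :: tr', step a i s s' & fox w s' tr'].
Proof. by case: tr => //= s' tr /andP[? ?]; exists s', tr. Qed.

Lemma fox_nilP s tr : fox [::] s tr -> tr = [::].
Proof. by case: tr. Qed.

Lemma stepSP a i s s' : step a i.+1 s s' ->
  exists x t t', [/\ s = x :: t, s' = x :: t' & step a i t t'].
Proof.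
by case: s s' => [|x s] [|y s'] //= /andP[/eqP<- ?]; exists x, s, s'.
Qed.

Lemma step_cupP d s s' : step (Cup d) 0 s s' -> exists x, s' = [:: x, x & s].
Proof. by case: s' => [|x [|y s']] //= /andP[/eqP<- /eqP->]; exists x. Qed.

Lemma step_capP s s' : step Cap 0 s s' -> exists x, s = [:: x, x & s'].
Proof. by case: s => [|x [|y s]] //= /andP[/eqP<- /eqP->]; exists x. Qed.

Lemma step_crossP b s s' : step (Cross b) 0 s s' -> exists x y t,
  s = [:: x, y & t] /\
  s' = if b then [:: x + x - y, x & t] else [:: y, y + y - x & t].
Proof. by case: s => [|x [|y s]] //= /eqP->; exists x, y, s. Qed.

(** Only one u is cancelled and 2 is not inverted, so that kinks force equal colours over Z/4
    too. *)
Lemma turn_fix (u x : A) : u = u + u - x -> x = u.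
Proof.
by move/eqP; rewrite eq_sym subr_eq eq_sym (inj_eq (addrI u)) => /eqP.
Qed.

Ltac fox_inv :=
  repeat match goal with
  | H : is_true (fox (_ :: _) _ _) |- _ =>
      apply fox_consP in H; destruct H as (? & ? & [-> ? H])
  | H : is_true (fox [::] _ _) |- _ => apply fox_nilP in H; subst
  | H : is_true (step _ _.+1 _ _) |- _ =>
      apply stepSP in H; destruct H as (? & ? & ? & [? ? H])
  | H : is_true (step (Cup _) 0 _ _) |- _ =>
      apply step_cupP in H; destruct H as (? & ?)
  | H : is_true (step Cap 0 _ _) |- _ =>
      apply step_capP in H; destruct H as (? & ?)
  | H : is_true (step (Cross ?b) 0 _ _) |- _ =>
      apply step_crossP in H; destruct H as (? & ? & ? & ? & ?)
  | H : _ :: _ = _ :: _ |- _ => injection H; clear H; intros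
  | H : ?u = ?u + ?u - _ |- _ => apply turn_fix in H
  | H : ?u + ?u - _ = ?u |- _ => symmetry in H
  | _ => progress subst
  end.

Definition equilift B l r : Prop := lifts B l r /\ lifts B r l.

(* The rules at i.+1 are the shifts of those at i, so that it is enough to    *)
(* treat i = 0.                                                               *)
Lemma equilift_shift B l r : equilift B l r -> equilift B (shift l) (shift r).
Proof. by case=> ? ?; split; apply: lifts_shift. Qed.

(** The double of 2u - v is 2(2u) - 2v, which is 2c as soon as 2u and 2v are. *)
Lemma mono_cross c b i s s' : step (Cross b) i s s' -> mono c s -> mono c s'.
Proof.
have reflect u v : u + u == c + c -> v + v == c + c ->
    u + u - v + (u + u - v) == c + c.
  move=> /eqP uc /eqP vc.
  have -> : u + u - v + (u + u - v) = (u + u) + (u + u) - (v + v) by ring.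
  by rewrite uc vc addrK.
elim: i s s' => [|i IH] s s'; last first.
  case: s s' => [|x s] [|x' s'] //= /andP[/eqP<- /IH st] /andP[->].
  exact: st.
case: s => [|x [|y s]] //= /eqP-> /and3P[xc yc sc].
by case: b; rewrite /= ?xc ?yc ?sc reflect.
Qed.

Definition fits (T : Type) (s : seq T) : pred event :=
  fun e => (e.2.+1 < size s)%N.

Definition crossing : pred event :=
  fun e => if e.1 is Cross _ then true else false.

Fixpoint turns (w : seq event) (s : seq A) : seq (seq A) :=
  if w is (Cross b, i) :: w' then
    let s' := turn b i s in s' :: turns w' s'
  else [::].

Lemma size_turn b i s : size (turn b i s) = size s.
Proof.
by elim: i s => [|i IH] [|x s] //=; [case: s; case: b | rewrite IH].
Qed.

Lemma step_turn b i s s' :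
  step (Cross b) i s s' = (i.+1 < size s)%N && (s' == turn b i s).
Proof.
elim: i s s' => [|i IH] [|x s] [|x' s'] //=; first by rewrite andbF.
by rewrite IH ltnS eqseq_cons eq_sym andbCA.
Qed.

Lemma fox_turns w s tr : all crossing w ->
  fox w s tr = all (fits s) w && (tr == turns w s).
Proof.
elim: w s tr => [|[a i] w IH] s tr /=; first by case: tr.
case: a => // b /= cw; case: tr => [|s' tr]; first by rewrite andbF.
rewrite step_turn IH // eqseq_cons -!andbA; congr andb.
by case: eqP => [->|]; rewrite ?andbF // /fits size_turn.
Qed.

Lemma mono_turns c w s : all crossing w -> all (fits s) w ->
  all (mono c) (s :: turns w s) = mono c s.
Proof.
elim: w s => [|[a i] w IH] s; first by rewrite /= andbT.
case: a => // b cw /andP[si sw].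
have /= := IH (turn b i s) cw; rewrite /fits size_turn => /(_ sw) ->.
have := @mono_cross c b i s (turn b i s).
rewrite step_turn [X in X && _]si eqxx => /(_ isT).
by case: (mono c s) => //= ->.
Qed.

Ltac mono_tac :=
  let c := fresh "c" in
  move=> c; rewrite /mono /=;
  repeat match goal with
  | |- context [ all ?p ?s ] => case: (all p s); rewrite ?andbF //=
  | |- context [ (?x + ?x == c + c) ] =>
     case: (x + x == c + c); rewrite ?andbF //=
  end.

Ltac gauge_to d e :=
  first [ have -> : gauge d = gauge e by congr gauge; ring
        | have -> : gauge d = gauge e by rewrite -gaugeN; congr gauge; ring ].

(** Each weight in the goal is, up to the sign of its argument, the gauge of a, b, a + b or a - b;
    the parallelogram bound then leaves linear arithmetic. *)
Ltac gauge_tac a b :=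
  have := gauge_parallelogram a b; rewrite ?subr0 ?addr0;
  repeat match goal with |- context [gauge ?d] =>
    lazymatch d with
    | a => fail | b => fail | a + b => fail | a - b => fail
    | _ => first [ gauge_to d a | gauge_to d b
                 | gauge_to d (a + b) | gauge_to d (a - b) ]
    end
  end; rewrite ?expr0 ?expr1 ?mul1r ?mulN1r; clear; lia.

(** * Behaviour of the count under each move *)

Lemma equilift_zigzagL d i : equilift 0 [:: (Cup d, i); (Cap, i.+1)] [::].
Proof.
elim: i => [|i IH]; last exact: (equilift_shift IH).
split=> o s tr so ru f; fox_inv; first by exists [::]; split=> //=; mono_tac.
(* The zigzag runs on o, which therefore contains a strand to bend. *)
case: o so ru => [|e o]; case: s => [|x s] //= so _.
by exists [:: [:: x, x, x & s]; x :: s]; rewrite /= !eqxx; split=> //; mono_tac.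
Qed.

Lemma equilift_zigzagR d i : equilift 0 [:: (Cup d, i.+1); (Cap, i)] [::].
Proof.
elim: i => [|i IH]; last exact: (equilift_shift IH).
split=> o s tr so ru f; fox_inv; first by exists [::]; split=> //=; mono_tac.
case: o so ru => [|e o]; case: s => [|x s] //= so _.
by exists [:: [:: x, x, x & s]; x :: s]; rewrite /= !eqxx; split=> //; mono_tac.
Qed.

Ltac slide_tac :=
  rewrite /= ?subKr !eqxx; split=> //; [| by mono_tac];
  match goal with |- context [gauge (?x - ?y)] =>
    by gauge_tac (x - y) (0 : A) end.

(** The type of the crossing and the parity of its position both change, so its shading sign does
    not. *)
Lemma equilift_slideCap b i :
  equilift 0 [:: (Cross b, i); (Cap, i.+1)] [:: (Cross (~~ b), i.+1); (Cap, i)].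
Proof.
elim: i => [|i IH]; last exact: (equilift_shift IH).
split=> o s tr _ _ f.
  by exists [:: turn (~~ b) 1 s; last s tr]; case: b f => f; fox_inv; slide_tac.
by exists [:: turn b 0 s; last s tr]; case: b f => f; fox_inv; slide_tac.
Qed.

Lemma equilift_slideCup d b i :
  equilift 0 [:: (Cup d, i); (Cross b, i.+1)]
             [:: (Cup d, i.+1); (Cross (~~ b), i)].
Proof.
elim: i => [|i IH]; last exact: (equilift_shift IH).
split=> o s tr _ _ f.
  (* The right leg of the moved minimum reaches the top level in position 2 without meeting the
     crossing, so its colour is read there. *)
  exists (let x := nth 0 (last s tr) 2 in
          [:: [:: head 0 s, x, x & behead s]; last s tr]).
  by case: b f => f; fox_inv; slide_tac.
exists (let x := nth 0 (last s tr) 0 in [:: [:: x, x & s]; last s tr]).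
by case: b f => f; fox_inv; slide_tac.
Qed.

Ltac kink_tac :=
  rewrite /= ?addrK ?eqxx ?subrr ?gauge0 ?mulr0; split=> //; mono_tac.

(** The two strands at the crossing of a kink have the same colour, so its weight is zero. *)
Lemma equilift_kinkR d b i :
  equilift 0 [:: (Cup d, i.+1); (Cross b, i); (Cap, i.+1)] [::].
Proof.
elim: i => [|i IH]; last exact: (equilift_shift IH).
split=> o s tr so ru f; last first.
  case: o so ru => [|e o]; case: s f => [|x s] f //= so _; fox_inv.
  exists [:: [:: x, x, x & s]; [:: x, x, x & s]; x :: s].
  by case: b; kink_tac.
exists [::]; case: b f {ru} => f; fox_inv.
  by kink_tac.
by kink_tac.
Qed.

Lemma equilift_kinkL d b i :
  equilift 0 [:: (Cup d, i); (Cross b, i.+1); (Cap, i)] [::].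
Proof.
elim: i => [|i IH]; last exact: (equilift_shift IH).
split=> o s tr so ru f; last first.
  case: o so ru => [|e o]; case: s f => [|x s] f //= so _; fox_inv.
  exists [:: [:: x, x, x & s]; [:: x, x, x & s]; x :: s].
  by case: b; kink_tac.
exists [::]; case: b f {ru} => f; fox_inv.
  by kink_tac.
by kink_tac.
Qed.

Lemma run_crossing w o : all crossing w -> run w o -> all (fits o) w.
Proof.
elim: w o => [|[a i] w IH] o //; case: a => // b /= cw.
rewrite run_cons /=; case def: (drop i o) => [|x [|y t]] //=.
have := size_drop i o; rewrite def /= => sz.
have oi : (i.+1 < size o)%N by lia.
move=> /(IH _ cw); rewrite /fits oi size_cat size_take (ltnW oi) /= sz.
by rewrite subnKC // ltnW // ltnW.
Qed.

(** In a word of crossings the bottom level determines the colouring and whether it is trivial; only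
    top levels and counts remain to be compared. *)
Lemma equilift_turns B l r : all crossing l -> all crossing r ->
    (forall s, all (fits s) (l ++ r) ->
       last s (turns r s) = last s (turns l s) /\
       `|phi r s (turns r s) - phi l s (turns l s)| <= B) ->
  equilift B l r.
Proof.
move=> cl cr H; split=> o s tr so /run_crossing bd;
    rewrite fox_turns // => /andP[fs /eqP->]; rewrite /fits so in bd.
  have fs' : all (fits s) r := bd cr.
  have [|la ph] := H s; first by rewrite all_cat fs.
  exists (turns r s); rewrite fox_turns // fs' eqxx; split=> // c.
  by rewrite !mono_turns.
have fs' : all (fits s) l := bd cl.
have [|la ph] := H s; first by rewrite all_cat fs fs'.
exists (turns l s); rewrite fox_turns // fs' eqxx distrC; split=> // c.
by rewrite !mono_turns.
Qed.

Lemma equilift_bigon b i : equilift 0 [:: (Cross b, i); (Cross (~~ b), i)] [::].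
Proof.
elim: i => [|i IH]; last exact: (equilift_shift IH).
apply: equilift_turns => // -[|x [|y s]] // _.
case: b; split; rewrite /= ?subKr //; gauge_tac (x - y) (0 : A).
Qed.

Lemma equilift_triangle (r s t : bool) i : (r == t) ==> (s == r) ->
  equilift 7 [:: (Cross r, i); (Cross s, i.+1); (Cross t, i)]
             [:: (Cross t, i.+1); (Cross s, i); (Cross r, i.+1)].
Proof.
move=> rst; elim: i => [|i IH]; last exact: (equilift_shift IH).
apply: equilift_turns => // -[|x [|y [|z u]]] // _.
split.
  by move: rst; case: r; case: s; case: t => //= _;
    congr [:: _, _, _ & _]; ring.
(* The two arguments are the differences of the colours of the upper and the *)
(* middle strand, and of the middle and the lower strand, at one crossing    *)
(* of each of these pairs.                                                   *)
move: rst; case: r; case: s; case: t => //= _.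
- gauge_tac (x - y) (y - z).
- gauge_tac (x - z) (y - z).
- gauge_tac (x - y) (x - z).
- gauge_tac (x - y) (y + y - x - z).
- gauge_tac (y - z) (y + y - x - z).
- gauge_tac (x - y) (y - z).
Qed.

Lemma fox_cons a i w s s' tr :
  fox ((a, i) :: w) s (s' :: tr) = step a i s s' && fox w s' tr.
Proof. by []. Qed.

Lemma phi_cons a i w s s' tr :
  phi ((a, i) :: w) s (s' :: tr) = weight a i s + phi w s' tr.
Proof. by []. Qed.

Lemma step0_split a s s' : step a 0 s s' -> exists p p' q,
  [/\ s = p ++ q, s' = p' ++ q, size p = legs_below a, size p' = legs_above a
    & forall q', step a 0 (p ++ q') (p' ++ q') /\
                 weight a 0 (p ++ q') = weight a 0 s].
Proof.
case: a => [d||b].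
- case/step_cupP=> x ->; exists [::], [:: x; x], s.
  by split=> //= q; rewrite !eqxx.
- case/step_capP=> x ->; exists [:: x; x], [::], s'.
  by split=> //= q; rewrite !eqxx.
case/step_crossP=> x [y [t [-> ->]]].
exists [:: x; y], (turn b 0 [:: x; y]), t.
by split; case: b => //= q; rewrite !eqxx.
Qed.

Lemma step_cat b k p q q' :
  step b (size p + k) (p ++ q) (p ++ q') = step b k q q'.
Proof. by elim: p => //= x p ->; rewrite eqxx. Qed.

Lemma step_split b n k s s' : step b (n + k) s s' -> exists p q q',
  [/\ s = p ++ q, s' = p ++ q', size p = n & step b k q q'].
Proof.
elim: n s s' => [|n IH] s s' st; first by exists [::], s, s'.
move/stepSP: st => [x [t [t' [-> -> /IH[p [q [q' [-> -> <- st]]]]]]]].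
by exists (x :: p), q, q'.
Qed.

Lemma weight_cat b k p q :
  weight b (size p + k) (p ++ q) = (-1) ^+ size p * weight b k q.
Proof.
elim: p => [|x p IH] /=; first by rewrite mul1r.
by rewrite IH exprS mulN1r mulNr.
Qed.

(** Pieces have 0 or 2 legs on each side, so positions move by even amounts and shading signs are
    kept. *)
Lemma equilift_exchange a b i k :
  equilift 0 [:: (a, i); (b, i + legs_above a + k)%N]
             [:: (b, i + legs_below a + k)%N; (a, i)].
Proof.
elim: i => [|i IH]; last exact: (equilift_shift IH).
have even_below : (-1) ^+ legs_below a = 1 :> int by case: (a).
have even_above : (-1) ^+ legs_above a = 1 :> int by case: (a).
split=> o s tr _ _ /fox_consP[s1 [tr1 [-> st1 /fox_consP[s2 [tr2 [-> st2]]]]]];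
    move=> /fox_nilP ->; rewrite !add0n in st1 st2 *.
  have [p [p' [q [-> def sp sp' pad]]]] := step0_split st1.
  have [p2 [q2 [q2' [def2 -> sp2 st]]]] := step_split st2.
  have : p' ++ q == p2 ++ q2 by rewrite -def def2.
  rewrite eqseq_cat ?sp' // => /andP[/eqP ? /eqP ?]; subst p2 q2 s1.
  exists [:: p ++ q2'; p' ++ q2'].
  have [pad1 wt] := pad q2'.
  split=> //; first by rewrite !fox_cons ?add0n -sp step_cat st pad1.
    rewrite !phi_cons ?add0n wt -sp -sp' !weight_cat sp sp'.
    rewrite even_below even_above.
    rewrite ![phi [::] _ _]/=; lia.
  by move=> c; rewrite /mono /= !all_cat; do 4!case: (all _ _).
have [p [q [q' [-> def sp st]]]] := step_split st1.
have [p2 [p2' [q2 [def2 -> sp2 sp2' pad]]]] := step0_split st2.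
have : p ++ q' == p2 ++ q2 by rewrite -def def2.
rewrite eqseq_cat ?sp ?sp2 // => /andP[/eqP ? /eqP ?]; subst p2 q2 s1.
exists [:: p2' ++ q; p2' ++ q'].
have [pad1 wt] := pad q.
split=> //; first by rewrite !fox_cons ?add0n -sp2' step_cat st pad1.
  rewrite !phi_cons ?add0n wt -sp -sp2' !weight_cat sp sp2'.
  rewrite even_below even_above.
  rewrite ![phi [::] _ _]/=; lia.
by move=> c; rewrite /mono /= !all_cat; do 4!case: (all _ _).
Qed.

(** * Transport of colourings along sequences of moves *)

Lemma step_size a i s s' o o' : size o = size s -> step a i s s' ->
  act (a, i) o = Some o' -> size o' = size s'.
Proof.
elim: i s s' o o' => [|i IH] s s' o o' so.
  case: a => [d||b].
  - by case/step_cupP=> x -> [<-] /=; rewrite take0 drop0 /= so.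
  - case/step_capP=> x def; move: so; rewrite {}def /= drop0.
    by case: o => [|y [|z o]] //= [so]; case: ifP => // _ [<-].
  case/step_crossP=> x [y [t [def ->]]]; move: so; rewrite {}def /= drop0.
  by case: o => [|u [|v o]] //= [so] [<-]; case: b; rewrite /= so.
case/stepSP=> x [t [t' [def -> st]]]; move: so; rewrite {}def.
case: o => //= d o [so]; rewrite [X in X = Some _]act_shift.
case def: (act (a, i) o) => [o1|] //= [<-] /=.
by rewrite (IH _ _ _ _ so st def).
Qed.

Lemma fox_run_size w s tr o o' : size o = size s -> fox w s tr ->
  run w o = Some o' -> size o' = size (last s tr).
Proof.
elim: w s tr o => [|[a i] w IH] s tr o so; first by move/fox_nilP-> => -[<-].
case/fox_consP=> s1 [tr1 [-> st f]]; rewrite run_cons.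
case def: (act _ o) => [o1|] //=; apply: IH f.
exact: step_size st def.
Qed.

Lemma fox_catP u v s tr : fox (u ++ v) s tr -> exists t1 t2,
  [/\ tr = t1 ++ t2, size t1 = size u, fox u s t1 & fox v (last s t1) t2].
Proof.
elim: u s tr => [|[a i] u IH] s tr; first by exists [::], tr.
case/fox_consP=> s1 [tr1 [-> st /IH[t1 [t2 [-> sz f1 f2]]]]].
by exists (s1 :: t1), t2; rewrite /= sz st.
Qed.

Lemma local_move_lift B (rule : seq event -> seq event -> Prop) D D' tr :
    (forall l r, rule l r -> equilift B l r) -> local_move rule D D' ->
    fox (val D) [::] tr ->
  exists tr', [/\ fox (val D') [::] tr',
    `|phi (val D') [::] tr' - phi (val D) [::] tr| <= B
    & forall c, all (mono c) tr' = all (mono c) tr].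
Proof.
move=> ruleB [u [v [l [r [-> defD' lr]]]]].
have {ruleB lr} lr : lifts B l r by case: lr => /ruleB[].
have := valP D'; rewrite {}defD' /is_closed !run_cat.
case runu: (run u [::]) => [o|] //=; rewrite run_cat.
case runr: (run r o) => [o'|] //= _.
case/fox_catP=> t1 [t2 [-> s1 f1 /fox_catP[t3 [t4 [-> s3 f3 f4]]]]].
have so := fox_run_size (erefl 0%N : size [::] = size [::]) f1 runu.
have [|t3' [f3' la ph mo]] := lr o _ _ so _ f3; first by rewrite runr.
have s3' := fox_size f3'.
exists (t1 ++ t3' ++ t4).
split; first by rewrite !fox_cat // f1 f3' la f4.
  by rewrite !phi_cat // la opprD addrACA subrr add0r opprD addrACA subrr addr0.
move=> c; rewrite !all_cat; case t1c: (all (mono c) t1) => //=.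
have := mo c; rewrite /= -!/(mono c _).
(* The level at which the move starts is one of t1 or the empty bottom level. *)
have -> : mono c (last [::] t1).
  by have := mem_last [::] t1; rewrite inE => /predU1P[->|/(allP t1c)].
by move=> /= ->.
Qed.

Lemma joined_lift k D D' tr : joined k D D' -> fox (val D) [::] tr ->
  exists tr', [/\ fox (val D') [::] tr',
    `|phi (val D') [::] tr' - phi (val D) [::] tr| <= 7 * k%:Z
    & forall c, all (mono c) tr' = all (mono c) tr].
Proof.
have compose B C Da Db Dc t1 t2 :
    `|phi (val Db) [::] t2 - phi (val Da) [::] t1| <= B ->
  fox (val Db) [::] t2 ->
  (forall c, all (mono c) t2 = all (mono c) t1) ->
  (exists t3, [/\ fox (val Dc) [::] t3,
    `|phi (val Dc) [::] t3 - phi (val Db) [::] t2| <= C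
    & forall c, all (mono c) t3 = all (mono c) t2]) ->
  exists t3, [/\ fox (val Dc) [::] t3,
    `|phi (val Dc) [::] t3 - phi (val Da) [::] t1| <= B + C
    & forall c, all (mono c) t3 = all (mono c) t1].
  move=> h12 f2 m12 [t3 [f3 h23 m23]]; exists t3; split=> //; first by lia.
  by move=> c; rewrite m23.
move=> j; elim: j tr => {k D D'}.
- by move=> D tr f; exists tr; rewrite subrr.
- move=> k Da Db Dc /local_move_lift lift _ IH tr /(lift 0)[l r|t2 [f2 h m]].
    case=> *; [exact: equilift_exchange | exact: equilift_zigzagL
      | exact: equilift_zigzagR | exact: equilift_slideCap
      | exact: equilift_slideCup].
  by rewrite -[7 * _]add0r; apply: compose (IH _ f2).
- move=> k Da Db Dc /local_move_lift lift _ IH tr /(lift 0)[l r|t2 [f2 h m]].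
    by case=> *; [exact: equilift_kinkR | exact: equilift_kinkL].
  by rewrite -[7 * _]add0r; apply: compose (IH _ f2).
- move=> k Da Db Dc /local_move_lift lift _ IH tr /(lift 0)[l r|t2 [f2 h m]].
    by case=> *; exact: equilift_bigon.
  by rewrite -[7 * _]add0r; apply: compose (IH _ f2).
move=> k Da Db Dc /local_move_lift lift _ IH tr /(lift 7)[l r|t2 [f2 h m]].
  by case=> *; exact: equilift_triangle.
have -> : 7 * k.+1%:Z = 7 + 7 * k%:Z by lia.
by apply: compose (IH _ f2).
Qed.

(** * Enumeration of colourings and lower bounds *)

Fixpoint next (palette : seq A) (a : piece) (i : nat) (s : seq A) :
    seq (seq A) :=
  match i, s with
  | i.+1, x :: s => [seq x :: s' | s' <- next palette a i s]
  | i.+1, [::] => [::]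
  | 0, _ =>
    match a with
    | Cup _ => [seq [:: x, x & s] | x <- palette]
    | Cap => if s is x :: y :: t then if x == y then [:: t] else [::] else [::]
    | Cross b => [:: turn b 0 s]
    end
  end.

Fixpoint colourings (palette : seq A) (w : seq event) (s : seq A) :
    seq (seq (seq A)) :=
  if w is (a, i) :: w' then
    [seq s' :: tr | s' <- next palette a i s, tr <- colourings palette w' s']
  else [:: [::]].

Lemma mem_next palette a i s s' : (forall x, x \in palette) ->
  step a i s s' -> s' \in next palette a i s.
Proof.
move=> full; elim: i s s' => [|i IH] s s'; last first.
  by case/stepSP=> x [t [t' [-> -> /IH]]]; apply: map_f.
case: a => [d||b] st.
- by have [x ->] := step_cupP st; apply: map_f.
- by have [x ->] := step_capP st; rewrite /= eqxx mem_head.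
by case/andP: st => _ /eqP->; apply: mem_head.
Qed.

(** Completeness is all that is shown of the enumeration, so a list taken from it is tested by [fox]
    when a colouring has to be exhibited. *)
Lemma mem_colourings palette w s tr : (forall x, x \in palette) ->
  fox w s tr -> tr \in colourings palette w s.
Proof.
move=> full; elim: w s tr => [|[a i] w IH] s tr; first by move/fox_nilP->.
case/fox_consP=> s' [tr' [-> /(mem_next full) st /IH f]].
by apply/allpairsPdep; exists s', tr'.
Qed.

End Fox.

Definition palette (n : nat) : seq 'I_n.+2 := [seq inZp i | i <- iota 0 n.+2].

Lemma mem_palette n (x : 'I_n.+2) : x \in palette n.
Proof.
by rewrite -[x]valZpK; apply: map_f; rewrite mem_iota /= ltn_ord.
Qed.

(** Over Z/4 this rules out colourings by 0 and 2 alone, whose differences have the smaller weight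
    1. *)
Definition nontrivial n (tr : seq (seq 'I_n.+2)) : bool :=
  ~~ has (fun c => all (mono c) tr) (palette n).

Lemma joined_phi n (u v : int) k D D' :
    has (fun tr => [&& fox (val D) [::] tr, nontrivial tr
                     & phi (val D) [::] tr == u])
        (colourings (palette n) (val D) [::]) ->
    all (fun tr => nontrivial tr ==> (phi (val D') [::] tr == v))
        (colourings (palette n) (val D') [::]) ->
    joined k D D' ->
  `|v - u| <= 7 * k%:Z.
Proof.
case/hasP=> tr _ /and3P[f nt /eqP<-] /allP all_v j.
have [tr' [f' h m]] := joined_lift j f.
have := all_v _ (mem_colourings (@mem_palette n) f').
by rewrite /nontrivial (eq_has m) -/(nontrivial tr) nt => /eqP<-.
Qed.

Lemma trefoil_bound k : joined k D1 D2 -> (2 <= k)%N.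
Proof.
move=> j; suff : `|-6 - 6| <= 7 * k%:Z by lia.
(* The ring is ['I_n.+2], so n = 1 stands for Z/3; the three crossings have weight 2 each. *)
by apply: (joined_phi (n := 1) _ _ j); vm_compute.
Qed.

Lemma figure_eight_bound k : joined k D3 D4 -> (3 <= k)%N.
Proof.
move=> j; suff : `|8 - (-8)| <= 7 * k%:Z by lia.
by apply: (joined_phi (n := 3) _ _ j); vm_compute.
Qed.

Lemma torus_link_bound k : joined k D5 D6 -> (3 <= k)%N.
Proof.
move=> j; suff : `|-8 - 8| <= 7 * k%:Z by lia.
by apply: (joined_phi (n := 2) _ _ j); vm_compute.
Qed.

Close Scope ring_scope.

(** * Explicit sequences of moves and upper bounds *)

(** Working on bare words lets the positions of the moves be checked by computation, without
    closedness proofs in the terms. *)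
Definition reach (k : nat) (w w' : seq event) : Prop :=
  exists c c', joined k (exist _ w c) (exist _ w' c').

Definition substitute (n : nat) (l r w : seq event) : seq event :=
  take n w ++ r ++ drop (n + size l) w.

Lemma reach_refl w : is_closed w -> reach 0 w w.
Proof. by move=> c; exists c, c; constructor. Qed.

Lemma local_substitute (rule : seq event -> seq event -> Prop) n l r w c c' :
    rule l r \/ rule r l -> take (size l) (drop n w) = l ->
  local_move rule (exist _ w c) (exist _ (substitute n l r w) c').
Proof.
move=> lr lw; exists (take n w), (drop (n + size l) w), l, r; split=> //=.
by rewrite -{1}(cat_take_drop n w) -{1}(cat_take_drop (size l) (drop n w)) lw
           drop_drop addnC.
Qed.

Lemma reach_iso n l r w w' k :
    isotopy_rule l r \/ isotopy_rule r l -> is_closed w ->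
    take (size l) (drop n w) = l -> reach k (substitute n l r w) w' ->
  reach k w w'.
Proof.
move=> lr c lw [c1 [c' j]]; exists c, c'.
by apply: joined_isotopy j; apply: local_substitute.
Qed.

Lemma reach_R1 n l r w w' k :
    R1_rule l r \/ R1_rule r l -> is_closed w ->
    take (size l) (drop n w) = l -> reach k (substitute n l r w) w' ->
  reach k w w'.
Proof.
move=> lr c lw [c1 [c' j]]; exists c, c'.
by apply: joined_R1 j; apply: local_substitute.
Qed.

Lemma reach_R2 n l r w w' k :
    R2_rule l r \/ R2_rule r l -> is_closed w ->
    take (size l) (drop n w) = l -> reach k (substitute n l r w) w' ->
  reach k w w'.
Proof.
move=> lr c lw [c1 [c' j]]; exists c, c'.
by apply: joined_R2 j; apply: local_substitute.
Qed.

Lemma reach_R3 n l r w w' k :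
    R3_rule l r \/ R3_rule r l -> is_closed w ->
    take (size l) (drop n w) = l -> reach k (substitute n l r w) w' ->
  reach k.+1 w w'.
Proof.
move=> lr c lw [c1 [c' j]]; exists c, c'.
by apply: joined_R3 j; apply: local_substitute.
Qed.

Ltac forward move n rule := apply: (move n _ _ _ _ _ (or_introl rule)) => //.
Ltac backward move n rule := apply: (move n _ _ _ _ _ (or_intror rule)) => //.

(* The following sequences of moves were found by a computer search.          *)
Lemma reach_trefoil : reach 2 (F_word 3) (E_word 3).
Proof.
forward reach_iso 5 (Exchange Cap Cap 0 0).
backward reach_R1 3 (KinkL false true 1).
backward reach_iso 2 (Exchange (Cup false) (Cross true) 1 0).
backward reach_iso 1 (Exchange (Cup false) (Cup true) 1 1).
forward reach_iso 5 (Exchange Cap (Cross true) 1 0).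
backward reach_R3 3 (@Triangle true true true 2 isT).
forward reach_iso 6 (Exchange Cap (Cross true) 1 0).
backward reach_R3 4 (@Triangle true true true 2 isT).
backward reach_iso 2 (Exchange (Cross true) (Cup true) 2 0).
backward reach_iso 3 (Exchange (Cross true) (Cup true) 2 0).
forward reach_iso 7 (Exchange Cap Cap 1 1).
forward reach_iso 6 (Exchange (Cross true) Cap 2 0).
forward reach_R1 4 (KinkR true true 3).
exact: reach_refl.
Qed.

Lemma reach_figure_eight : reach 3 D3_word D4_word.
Proof.
backward reach_iso 5 (SlideCap false 1).
(* This brings the number of crossings to six; the two kinks removed below bring it back to four. *)
backward reach_R2 2 (Bigon true 0).
forward reach_iso 3 (Exchange (Cross false) (Cross true) 0 0).
backward reach_iso 8 (Exchange Cap Cap 0 0).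
backward reach_iso 7 (SlideCap true 0).
backward reach_iso 6 (Exchange (Cross true) (Cross true) 0 0).
forward reach_R3 4 (@Triangle false false true 0 isT).
backward reach_iso 1 (SlideCup true false 0).
forward reach_R3 2 (@Triangle false true true 1 isT).
backward reach_iso 0 (Exchange (Cup true) (Cup true) 0 0).
backward reach_iso 4 (Exchange (Cross false) (Cross false) 0 0).
backward reach_R3 5 (@Triangle true false false 1 isT).
backward reach_iso 7 (ZigzagR true 1).
forward reach_iso 8 (Exchange Cap (Cross false) 1 0).
forward reach_iso 7 (SlideCup true false 2).
forward reach_iso 9 (Exchange Cap Cap 1 0).
forward reach_R1 7 (KinkR true true 2).
backward reach_iso 6 (SlideCap true 1).
backward reach_iso 2 (ZigzagR false 2).
forward reach_iso 3 (Exchange Cap (Cross true) 2 0).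
forward reach_iso 2 (SlideCup false true 3).
forward reach_iso 1 (Exchange (Cup true) (Cup false) 2 0).
forward reach_R1 2 (KinkL true false 2).
backward reach_iso 1 (SlideCup false false 1).
backward reach_iso 2 (Exchange (Cross false) (Cross false) 0 0).
exact: reach_refl.
Qed.

Lemma reach_torus_link : reach 3 (F_word 4) (E_word 4).
Proof.
forward reach_iso 6 (Exchange Cap Cap 0 0).
backward reach_R1 5 (KinkL false true 1).
backward reach_iso 4 (Exchange (Cup false) (Cross true) 1 0).
backward reach_iso 3 (Exchange (Cup false) (Cross true) 1 0).
forward reach_iso 7 (Exchange Cap (Cross true) 1 0).
backward reach_R3 5 (@Triangle true true true 2 isT).
backward reach_iso 2 (Exchange (Cup false) (Cross true) 1 0).
backward reach_R3 4 (@Triangle true true true 2 isT).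
backward reach_iso 1 (Exchange (Cup false) (Cup true) 1 1).
backward reach_R3 3 (@Triangle true true true 2 isT).
backward reach_iso 2 (Exchange (Cross true) (Cup true) 2 0).
forward reach_iso 8 (Exchange Cap Cap 1 1).
forward reach_iso 7 (Exchange (Cross true) Cap 2 0).
forward reach_iso 6 (Exchange (Cross true) Cap 2 0).
forward reach_iso 5 (Exchange (Cross true) Cap 2 0).
forward reach_R1 3 (KinkR true true 3).
exact: reach_refl.
Qed.

Lemma reach_joined k (D D' : diagram) :
  reach k (val D) (val D') -> joined k D D'.
Proof.
case: D => w c; case: D' => w' c' [c1 [c1' j]].
by rewrite (bool_irrelevance c c1) (bool_irrelevance c' c1').
Qed.

Theorem theorem1p1 :
  [/\ Omega3_eq D1 D2 2, Omega3_eq D3 D4 3 & Omega3_eq D5 D6 3].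
Proof.
split; split.
- exact: (@reach_joined _ D1 D2 reach_trefoil).
- exact: trefoil_bound.
- exact: (@reach_joined _ D3 D4 reach_figure_eight).
- exact: figure_eight_bound.
- exact: (@reach_joined _ D5 D6 reach_torus_link).
exact: torus_link_bound.
Qed.
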